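(* Let $A_1,\dots,A_N$ be an MPU in canonical form. For $k=1,\dots,N$ define the linear map $V_k:(\mathbb C^d)^{\otimes k}\to\mathbb C^{D_k}\otimes(\mathbb C^d)^{\otimes k}$ by $$V_k=\sum_{i,j}\big(A_k^{i_kj_k}\cdots A_2^{i_2j_2}A_1^{i_1j_1}\big)\otimes|i_k\dots i_1\rangle\langle j_k\dots j_1| ,$$ where $A_k^{i_kj_k}\cdots A_1^{i_1j_1}\in\mathbb M_{D_k,1}$ is regarded as a vector in $\mathbb C^{D_k}$. Then $V_k^\dagger V_k=\mathbb 1$ for every $k$; that is, every MPU can be represented as a sequence of isometries $V_k$ ($k=1,\dots,N$) with $U=V_N$.
   Context: Let $d\ge1$ and bond dimensions $D_0,\dots,D_N$ with $D_0=D_N=1$ be given. A tensor $A_k$ is a family of matrices $A_k^{ij}\in\mathbb M_{D_k,D_{k-1}}(\mathbb C)$, $i,j\in\{1,\dots,d\}$ ($i$ = physical output, $j$ = physical input). The sequence $A_1,\dots,A_N$ generates an MPU (matrix-product unitary) if the operator $$U=\sum_{i,j}A_N^{i_Nj_N}\cdots A_2^{i_2j_2}A_1^{i_1j_1}\,|i_N\dots i_1\rangle\langle j_N\dots j_1|$$ on $(\mathbb C^d)^{\otimes N}$ is unitary (the matrix products are scalars since $D_0=D_N=1$). The MPU is in canonical form if for all $k=1,\dots,N$ $$\frac1d\sum_{i,j}\big(A_k^{ij}\big)^\dagger A_k^{ij}=\mathbb 1_{D_{k-1}} .$$ Every MPU can be represented by tensors in canonical form. *)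

(* Defs.v *)
From mathcomp Require Import all_boot all_order all_algebra.
From mathcomp Require Import reals.
From mathcomp Require Export complex.

Set Implicit Arguments.
Unset Strict Implicit.
Unset Printing Implicit Defensive.

Import GRing.Theory Num.Theory.
Local Open Scope ring_scope.
Local Open Scope sesquilinear_scope.

(* Bond dimensions D_0, ..., D_N; the values beyond N are irrelevant. *)
Record bonds (N : nat) := Bonds {
  bdim :> nat -> nat;
  bdim0 : bdim 0%N = 1%N;
  bdimN : bdim N = 1%N
}.

(* The unique index of a space of dimension m = 1. *)
Definition the_ord (m : nat) (h : m = 1%N) : 'I_m := cast_ord (esym h) ord0.

(* Computational basis of (C^d)^{(x) k}: the vector |i_k ... i_1> is labelled by
   i, where i_l = i (l - 1). *)
Definition basis (d k : nat) := {ffun 'I_k -> 'I_d}.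

(* Matrix of the operator \sum_(x, y) F x y |x><y|, for basis labels in finite
   types X and Y. *)
Definition opmx (C : Type) (X Y : finType) (F : X -> Y -> C) :
    'M[C]_(#|X|, #|Y|) :=
  \matrix_(r, c) F (enum_val r) (enum_val c).

(* The canonical identification of C^m (x) C^X with C^X when m = 1, applied to
   the codomain of an operator. *)
Definition drop_bond (C : Type) (m : nat) (h : m = 1%N) (X : finType) (n : nat)
    (V : 'M[C]_(#|{: 'I_m * X}|, n)) : 'M[C]_(#|X|, n) :=
  \matrix_(r, c) V (enum_rank (the_ord h, enum_val r)) c.

Definition is_isometry (C : numClosedFieldType) (m n : nat)
    (V : 'M[C]_(m, n)) : Prop :=
  V^t* *m V = 1%:M.

Section MPU.

Variables (R : realType) (d N : nat).

(* The complex field is R[i]. A k i j is the matrix A_k^{ij}, with i the output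
   and j the input; only A 1, ..., A N are meaningful. *)
Definition tensors (D : bonds N) :=
  forall k : nat, 'I_d -> 'I_d -> 'M[R[i]]_(D k, D k.-1).

Variables (D : bonds N) (A : tensors D).

(* A_k^{i_k j_k} ... A_1^{i_1 j_1} *)
Fixpoint chain (k : nat) : ('I_k -> 'I_d) -> ('I_k -> 'I_d) ->
    'M[R[i]]_(D k, D 0%N) :=
  match k with
  | 0 => fun _ _ => 1%:M
  | l.+1 => fun i j =>
      A l.+1 (i ord_max) (j ord_max)
        *m chain (fun s : 'I_l => i (widen_ord (leqnSn l) s))
                 (fun s : 'I_l => j (widen_ord (leqnSn l) s))
  end.

Definition mpo : 'M[R[i]]_(#|{: basis d N}|, #|{: basis d N}|) :=
  opmx (fun i j : basis d N =>
    chain i j (the_ord (bdimN D)) (the_ord (bdim0 D))).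

Definition is_mpu : Prop := mpo \is unitarymx.

Definition canonical_form : Prop :=
  forall k : nat, (1 <= k <= N)%N ->
    d%:R^-1 *: (\sum_(i < d) \sum_(j < d) (A k i j)^t* *m A k i j) = 1%:M.

(* The codomain C^{D_k} (x) (C^d)^{(x) k} has the product basis, labelled by
   pairs (a, i). *)
Definition Vmap (k : nat) :
    'M[R[i]]_(#|{: 'I_(D k) * basis d k}|, #|{: basis d k}|) :=
  opmx (fun (ai : 'I_(D k) * basis d k) (j : basis d k) =>
    chain ai.2 j ai.1 (the_ord (bdim0 D))).

End MPU.

(* Main.v *)
Require Import Defs.
From mathcomp Require Import all_boot all_order all_algebra.
From mathcomp Require Import reals.

(* Writing G_k = V_k^dagger V_k, the canonical form at site k+1 implies that
   tracing the last input of G_(k+1) out gives d G_k. Since G_N = U^dagger U = 1,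
   downward induction yields G_k = 1 for all k.
   For the existence of a canonical form, no decomposition is needed if the bond
   dimensions may be large: let the bond after site k carry the inputs and
   outputs of the sites k+1, ..., N, put all coefficients of U into the first
   tensor, and let the others read off one input/output pair each, up to the
   factor sqrt d. Canonicity at the first site is then the normalization
   tr (U^dagger U) = d^N. *)

Set Implicit Arguments.
Unset Strict Implicit.
Unset Printing Implicit Defensive.

Import GRing.Theory Num.Theory.

(** * Splitting the last site off a basis label *)

Section ExtendBasis.
Local Open Scope nat_scope.

Variables (d k : nat).

Definition extend_basis (x : basis d k) (q : 'I_d) : basis d k.+1 :=
  [ffun s => if unlift ord_max s is Some t then x t else q].

Lemma extend_basis_max x q : extend_basis x q ord_max = q.
Proof. by rewrite ffunE unlift_none. Qed.

Lemma extend_basis_widen x q s :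
  extend_basis x q (widen_ord (leqnSn k) s) = x s.
Proof.
rewrite ffunE (_ : widen_ord _ _ = lift ord_max s) ?liftK //.
by apply: val_inj; exact/esym/lift_max.
Qed.

Definition restrict_basis (x : basis d k.+1) : basis d k :=
  [ffun s => x (widen_ord (leqnSn k) s)].

Lemma extend_basisK :
  cancel (fun xq => extend_basis xq.1 xq.2)
         (fun x : basis d k.+1 => (restrict_basis x, x ord_max)).
Proof.
move=> [x q] /=; rewrite extend_basis_max; congr pair.
by apply/ffunP=> s; rewrite ffunE extend_basis_widen.
Qed.

Lemma restrict_basisK :
  cancel (fun x : basis d k.+1 => (restrict_basis x, x ord_max))
         (fun xq => extend_basis xq.1 xq.2).
Proof.
move=> x /=; apply/ffunP=> s; rewrite ffunE.
case: unliftP => [t ->|->] //; rewrite ffunE; congr (x _).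
by apply: val_inj; exact/esym/lift_max.
Qed.

Lemma extend_basis_eq x y q : (extend_basis x q == extend_basis y q) = (x == y).
Proof.
apply/eqP/eqP=> [e|-> //].
by have := extend_basisK (x, q); rewrite /= e (extend_basisK (y, q)) => -[].
Qed.

Lemma sum_extend_basis (V : nmodType) (F : basis d k.+1 -> V) :
  (\sum_x F x = \sum_x \sum_q F (extend_basis x q))%R.
Proof.
rewrite pair_big (reindex (fun xq : basis d k * 'I_d => extend_basis xq.1 xq.2)) //=.
by exists (fun x => (restrict_basis x, x ord_max)) => x _;
  [exact: extend_basisK | exact: restrict_basisK].
Qed.

End ExtendBasis.

Local Open Scope ring_scope.
Local Open Scope sesquilinear_scope.

Lemma trmxC_mul (C : numClosedFieldType) (m n p : nat)
    (M : 'M[C]_(m, n)) (P : 'M[C]_(n, p)) : (M *m P)^t* = P^t* *m M^t*.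
Proof. by rewrite trmx_mul map_mxM. Qed.

(** * Gram entries of the maps V_k and their partial traces *)

Section Gram.

Variables (R : realType) (d N : nat) (D : bonds N) (A : tensors R d D).
Local Notation C := R[i].

Lemma chainS k (i j : 'I_k.+1 -> 'I_d) :
  chain A i j = A k.+1 (i ord_max) (j ord_max)
    *m chain A (fun s => i (widen_ord (leqnSn k) s))
               (fun s => j (widen_ord (leqnSn k) s)).
Proof. by []. Qed.

Lemma chain_ext k (i i' j j' : 'I_k -> 'I_d) :
  i =1 i' -> j =1 j' -> chain A i j = chain A i' j'.
Proof.
elim: k i i' j j' => [//|k IH] i i' j j' ei ej /=; rewrite ei ej.
by rewrite (IH _ (fun s => i' (widen_ord (leqnSn k) s)) _
                 (fun s => j' (widen_ord (leqnSn k) s))) // => s.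
Qed.

Lemma chain_extend k (i j : basis d k) p q :
  chain A (extend_basis i p) (extend_basis j q) = A k.+1 p q *m chain A i j.
Proof.
rewrite chainS !extend_basis_max.
by congr (_ *m _); apply: chain_ext => s; rewrite extend_basis_widen.
Qed.

(* The entries of [V_k^dagger V_k], as matrices of size [D_0 = 1]. *)
Definition gram k (j j' : basis d k) : 'M[C]_(D 0%N) :=
  \sum_(i : basis d k) (chain A i j)^t* *m chain A i j'.

Definition tensor_gram k : 'M[C]_(D k.-1) :=
  \sum_(i < d) \sum_(j < d) (A k i j)^t* *m A k i j.

(** The last output and input occur only in the factor [A k.+1], so summing over both forms
    [tensor_gram k.+1] between the two shorter chains. *)
Lemma gram_partial_trace k (j j' : basis d k) :
  \sum_q gram (extend_basis j q) (extend_basis j' q) =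
  \sum_(i : basis d k) (chain A i j)^t* *m tensor_gram k.+1 *m chain A i j'.
Proof.
under eq_bigr do rewrite /gram sum_extend_basis.
rewrite exchange_big; apply: eq_bigr => i _; rewrite [LHS]exchange_big.
rewrite /tensor_gram mulmx_sumr mulmx_suml.
apply: eq_bigr => p _; rewrite mulmx_sumr mulmx_suml.
apply: eq_bigr => q _.
by rewrite !chain_extend trmxC_mul !mulmxA.
Qed.

Lemma gram_partial_trace_canonical k (j j' : basis d k) :
  tensor_gram k.+1 = d%:R%:M ->
  \sum_q gram (extend_basis j q) (extend_basis j' q) = d%:R *: gram j j'.
Proof.
move=> can; rewrite gram_partial_trace can scaler_sumr.
by apply: eq_bigr => i _; rewrite mul_mx_scalar scalemxAl.
Qed.

(** Tracing out the sites k+1, ..., 2 one by one gives a factor d each. Canonicity of site 1 is not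
    assumed, because it is to be deduced from this trace. *)
Lemma gram_trace k : (k < N)%N ->
  (forall l, (0 < l < N)%N -> tensor_gram l.+1 = d%:R%:M) ->
  \sum_(j : basis d k.+1) gram j j = d%:R ^+ k *: tensor_gram 1%N.
Proof.
move=> + can; elim: k => [|k IH] kN; rewrite sum_extend_basis.
  (* With no sites left there is a single label and the chain is the identity, so only
     [tensor_gram 1] survives. *)
  have b0 : basis d 0 by exact: ffun0 (card_ord 0).
  have un (x : basis d 0) : x = b0 by apply/ffunP => -[].
  rewrite (big_pred1 b0) => [|x]; last by rewrite (un x) /= eqxx.
  rewrite gram_partial_trace (big_pred1 b0) => [|x]; last by rewrite (un x) /= eqxx.
  by rewrite /= trmx1 map_mx1 mul1mx mulmx1 expr0 scale1r.
under eq_bigr do rewrite (gram_partial_trace_canonical _ _ (can _ _)) ?kN //.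
by rewrite -scaler_sumr IH ?(ltnW kN) // scalerA exprS.
Qed.

Lemma canonical_formP : (0 < d)%N ->
  canonical_form A <->
  forall k, (1 <= k <= N)%N -> tensor_gram k = d%:R%:M.
Proof.
move=> d0; have dn0 : d%:R != 0 :> C by rewrite pnatr_eq0 -lt0n.
split=> can k kN; have := can k kN; rewrite -/(tensor_gram k) => e.
  by rewrite -scalemx1 -e scalerA divff // scale1r.
by rewrite -/(tensor_gram k) e -scalemx1 scalerA mulVf // scale1r.
Qed.

Lemma Vmap_gram k (j j' : basis d k) :
  ((Vmap A k)^t* *m Vmap A k) (enum_rank j) (enum_rank j') =
  gram j j' (the_ord (bdim0 D)) (the_ord (bdim0 D)).
Proof.
rewrite !mxE (reindex_onto enum_rank enum_val) => [|r _]; last exact: enum_valK.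
rewrite (eq_bigl predT) => [|x]; last by rewrite /= enum_rankK eqxx.
rewrite /gram summxE.
under [RHS]eq_bigr do rewrite mxE.
rewrite exchange_big pair_big /=.
by apply: eq_bigr => -[a i] _; rewrite !mxE !enum_rankK.
Qed.

Lemma isometryP k :
  is_isometry (Vmap A k) <->
  forall j j' : basis d k, gram j j' = (j == j')%:R%:M.
Proof.
have u0 (i : 'I_(D 0%N)) : i = the_ord (bdim0 D).
  by apply: val_inj; case: i => i /=; rewrite bdim0 ltnS leqn0 => /eqP.
split=> [iso j j'|g].
  apply/matrixP=> a b; rewrite (u0 a) (u0 b) -Vmap_gram iso !mxE eqxx.
  by rewrite (inj_eq enum_rank_inj).
apply/matrixP=> r c; rewrite -(enum_valK r) -(enum_valK c) Vmap_gram g !mxE eqxx.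
by rewrite (inj_eq enum_rank_inj).
Qed.

Lemma mpo_drop_bond : mpo A = drop_bond (bdimN D) (Vmap A N).
Proof. by apply/matrixP=> r c; rewrite !mxE enum_rankK. Qed.

(** As D_N = 1, dropping the bond merely relabels the rows of V_N. *)
Lemma mpo_gram : (mpo A)^t* *m mpo A = (Vmap A N)^t* *m Vmap A N.
Proof.
have uN (i : 'I_(D N)) : i = the_ord (bdimN D).
  by apply: val_inj; case: i => i /=; rewrite bdimN ltnS leqn0 => /eqP.
apply/matrixP=> r c; rewrite !mxE.
rewrite [RHS](reindex_onto
  (fun s => enum_rank (the_ord (bdimN D), enum_val s))
  (fun s => enum_rank (enum_val s).2)) => [|s _]; last first.
  by rewrite enum_rankK -[RHS]enum_valK; case: (enum_val s) => a i; rewrite (uN a).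
rewrite [RHS](eq_bigl predT) => [|s]; last by rewrite /= enum_rankK enum_valK eqxx.
by apply: eq_bigr => s _; rewrite !mxE !enum_rankK.
Qed.

(** [unitarymx] says U U^dagger = 1; since U is square, this is the same as U^dagger U = 1. *)
Lemma is_mpu_isometry : is_mpu A <-> is_isometry (Vmap A N).
Proof.
rewrite /is_isometry -mpo_gram; split=> [/unitarymxP/mulmx1C //|/mulmx1C e].
exact/unitarymxP.
Qed.

Lemma canonical_isometry : (0 < d)%N -> is_mpu A -> canonical_form A ->
  forall k, (k <= N)%N -> is_isometry (Vmap A k).
Proof.
move=> d0 /is_mpu_isometry iso /(canonical_formP d0) can k kN.
have dn0 : d%:R != 0 :> C by rewrite pnatr_eq0 -lt0n.
(* Downward induction on k, run upward on m = N - k. *)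
rewrite -(subKn kN); elim: (N - k)%N (leq_subr k N) => [|m IH] mN.
  by rewrite subn0.
have := IH (ltnW mN); rewrite -[(N - m)%N]prednK ?subn_gt0 // -subnS.
set l := (N - m.+1)%N => /isometryP isol; apply/isometryP=> j j'.
have lN : (l < N)%N by rewrite /l -subn_gt0 subKn.
(* After multiplication by d, the claim at l is the partial trace of the identity at l+1. *)
apply: (scalerI dn0); rewrite -gram_partial_trace_canonical ?can //.
under eq_bigr do rewrite isol extend_basis_eq.
by rewrite sumr_const card_ord scaler_nat.
Qed.

End Gram.

(** * Canonical tensors with prescribed coefficients *)

Section Coefficients.

Variables (R : realType) (d n : nat) (d_gt0 : (0 < d)%N) (u : seq ('I_d * 'I_d) -> R[i]).
Local Notation C := R[i].
Local Notation c := (sqrtC d%:R : C).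

(* For [0 < k], the basis of the bond after site [k] consists of the words of
   output/input pairs on the sites [k+1, ..., n+1]. *)
Definition coef_bdim (k : nat) : nat :=
  if k is l.+1 then #|{: (n - l).-tuple ('I_d * 'I_d)}| else 1.

Lemma coef_bdimN : coef_bdim n.+1 = 1%N.
Proof. by rewrite /= subnn card_tuple expn0. Qed.

Definition coef_bonds : bonds n.+1 := Bonds (erefl : coef_bdim 0 = 1%N) coef_bdimN.

(** The factor [c ^- n] in the first tensor cancels the factors [c] of the n later ones, each of
    which removes the head of the word [b] if it is (i, j). *)
Definition coef_tensors : tensors R d coef_bonds := fun k =>
  match k with
  | 0 => fun _ _ => 0
  | 1 => fun i j =>
      \matrix_(a < coef_bdim 1, b < 1) (c ^- n * u ((i, j) :: enum_val a))
  | l.+2 => fun i j =>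
      \matrix_(a < coef_bdim l.+2, b < coef_bdim l.+1)
        (c *+ (tval (enum_val b) == (i, j) :: enum_val a))
  end.

Lemma sqrtC_nat_sqr : c ^+ 2 = d%:R.
Proof. exact: sqrtCK. Qed.

Lemma conj_sqrtC_nat : c^* = c.
Proof. by rewrite geC0_conj // sqrtC_ge0 ler0n. Qed.

Definition cons_label l (p : 'I_d * 'I_d) (ln : (l < n)%N)
    (a : 'I_(coef_bdim l.+2)) : 'I_(coef_bdim l.+1) :=
  enum_rank (tcast (subnSK ln) [tuple of p :: enum_val a]).

Lemma cons_labelK l p (ln : (l < n)%N) (a : 'I_(coef_bdim l.+2)) :
  tval (enum_val (cons_label p ln a)) = p :: enum_val a.
Proof. by rewrite enum_rankK val_tcast. Qed.

Lemma enum_val_tuple_inj m : injective (fun a : 'I_#|{: m.-tuple ('I_d * 'I_d)}| =>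
  tval (enum_val a)).
Proof. exact: inj_comp val_inj enum_val_inj. Qed.

(** In each product only one intermediate word contributes: the unread word [a] with the pair of the
    last site put back in front. *)
Lemma coef_chain k (i j : 'I_k.+1 -> 'I_d) a b : (k <= n)%N ->
  chain coef_tensors i j a b =
  c ^+ k * c ^- n * u ([seq (i s, j s) | s <- enum 'I_k.+1] ++ enum_val a).
Proof.
elim: k i j a b => [|k IH] i j a b kn.
  rewrite chainS /= mulmx1 mxE expr0 mul1r enum_ordSl.
  have -> : enum 'I_0 = [::] by apply: size0nil; rewrite size_enum_ord.
  by rewrite /= (_ : ord_max = ord0) //; apply: val_inj.
pose a' := cons_label (i ord_max, j ord_max) kn a.
rewrite chainS mxE (bigD1 a') // big1 => [|e ne].
  rewrite [LHS]addr0 (IH (fun s => i (widen_ord (leqnSn k.+1) s))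
    (fun s => j (widen_ord (leqnSn k.+1) s)) a' b (ltnW kn)).
  rewrite mxE cons_labelK eqxx mulr1n exprS !mulrA.
  congr (_ * u _); rewrite [enum 'I_k.+2]enum_ordSr map_rcons cat_rcons.
  by rewrite -map_comp.
rewrite mxE -(cons_labelK (i ord_max, j ord_max) kn a).
by rewrite (inj_eq (@enum_val_tuple_inj _)) (negPf ne) mul0r.
Qed.

Lemma cons_label_eq l p q (ln : (l < n)%N) (a a' : 'I_(coef_bdim l.+2)) :
  (tval (enum_val (cons_label p ln a)) == q :: enum_val a') =
  ((p, a) == (q, a')).
Proof.
by rewrite cons_labelK eqseq_cons (inj_eq (@enum_val_tuple_inj _)).
Qed.

Lemma cons_label_inj l p q (ln : (l < n)%N) (a a' : 'I_(coef_bdim l.+2)) :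
  (cons_label p ln a == cons_label q ln a') = ((p, a) == (q, a')).
Proof.
by rewrite -(inj_eq (@enum_val_tuple_inj _)) /= (cons_labelK q) cons_label_eq.
Qed.

Lemma cons_labelP l (ln : (l < n)%N) (b : 'I_(coef_bdim l.+1)) :
  exists p a, b = cons_label p ln a.
Proof.
pose t : (n - l.+1).+1.-tuple ('I_d * 'I_d) := tcast (esym (subnSK ln)) (enum_val b).
exists (thead t), (enum_rank [tuple of behead t]).
apply: enum_val_tuple_inj; rewrite cons_labelK enum_rankK.
have : tval t = enum_val b by rewrite val_tcast.
by rewrite {1}(tuple_eta t).
Qed.

(** A nonempty word splits uniquely into head and tail, so at most one term survives, and only on
    the diagonal, where it is [c] times its conjugate. *)
Lemma coef_tensor_gram l : (l < n)%N ->
  tensor_gram coef_tensors l.+2 = d%:R%:M.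
Proof.
move=> ln; apply/matrixP=> b b'; rewrite /tensor_gram summxE.
under eq_bigr do (rewrite summxE; under eq_bigr do rewrite mxE).
rewrite pair_bigA pair_bigA /=.
have [p [a ->]] := cons_labelP ln b; have [p' [a' ->]] := cons_labelP ln b'.
rewrite (bigD1 ((p.1, p.2), a)) //= big1 ?addr0 => [|[[i j] e] ne]; last first.
  rewrite !mxE cons_label_eq eq_sym; case: p ne => p1 p2 /negPf -> /=.
  by rewrite mulr0n conjC0 mul0r.
rewrite !mxE -surjective_pairing !cons_label_eq eqxx mulr1n conj_sqrtC_nat.
rewrite cons_label_inj [(p', a') == _]eq_sym.
by case: eqP => _; rewrite ?mulr0n ?mulr0 // !mulr1n -expr2 sqrtC_nat_sqr.
Qed.

Lemma mpo_coef_tensors x y :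
  mpo coef_tensors (enum_rank x) (enum_rank y) =
  u [seq (x s, y s) | s <- enum 'I_n.+1].
Proof.
rewrite mxE !enum_rankK coef_chain // mulfV ?mul1r; last first.
  by rewrite expf_neq0 // sqrtC_eq0 pnatr_eq0 -lt0n.
(* After the last site the unread word is empty. *)
congr u; set w := enum_val _.
have /size0nil -> : size w = 0%N by rewrite size_tuple subnn.
by rewrite cats0.
Qed.


Lemma coef_canonical_form : is_mpu coef_tensors -> canonical_form coef_tensors.
Proof.
move=> /is_mpu_isometry/isometryP iso; apply/(canonical_formP _ d_gt0).
have can l : (0 < l < n.+1)%N -> tensor_gram coef_tensors l.+1 = d%:R%:M.
  by case: l => // l /andP[_ ln]; exact: coef_tensor_gram.
case=> [|[|k]] // kn; last exact: can.
have dn0 : d%:R ^+ n != 0 :> C by rewrite expf_neq0 // pnatr_eq0 -lt0n.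
(* Site 1: by unitarity the full trace is the number d^(n+1) of labels, and cancelling d^n leaves
   d. *)
apply: (scalerI dn0); rewrite -gram_trace //.
under eq_bigr do rewrite iso eqxx.
by rewrite sumr_const card_ffun !card_ord -scaler_nat !scale_scalar_mx mulr1 natrX exprSr.
Qed.

End Coefficients.

Lemma mpo_coef_exists (R : realType) (d n : nat) (d_gt0 : (0 < d)%N)
    (U : 'M[R[i]]_(#|{: basis d n.+1}|, #|{: basis d n.+1}|)) :
  exists u, mpo (@coef_tensors R d n u) = U.
Proof.
(* [p0] is only the default of [nth]; the words met below have length n+1, so it is never
   returned. *)
pose p0 := (Ordinal d_gt0, Ordinal d_gt0).
exists (fun w => U (enum_rank [ffun s : 'I_n.+1 => (nth p0 w s).1])
                   (enum_rank [ffun s : 'I_n.+1 => (nth p0 w s).2])).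
apply/matrixP=> r c; rewrite -(enum_valK r) -(enum_valK c) mpo_coef_tensors //.
by congr (U (enum_rank _) (enum_rank _)); apply/ffunP=> s;
  rewrite ffunE (nth_map s) ?size_enum_ord // nth_ord_enum.
Qed.

Theorem corollary7 (R : realType) (d N : nat) (d_gt0 : (0 < d)%N) (N_gt0 : (0 < N)%N) :
  (forall (D : bonds N) (A : tensors R d D),
     is_mpu A -> canonical_form A ->
     (forall k : nat, (1 <= k <= N)%N -> is_isometry (Vmap A k))
     /\ mpo A = drop_bond (bdimN D) (Vmap A N))
  /\
  (forall (D : bonds N) (A : tensors R d D),
     is_mpu A ->
     exists (D' : bonds N) (A' : tensors R d D'),
       [/\ canonical_form A', mpo A' = mpo A,
           (forall k : nat, (1 <= k <= N)%N -> is_isometry (Vmap A' k))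
         & mpo A = drop_bond (bdimN D') (Vmap A' N)]).
Proof.
split=> D A mpuA.
  move=> canA; split=> [k /andP[_ kN]|]; last exact: mpo_drop_bond.
  exact: canonical_isometry.
case: N N_gt0 D A mpuA => // n _ D A mpuA.
have [u eU] := mpo_coef_exists d_gt0 (mpo A).
have mpuA' : is_mpu (coef_tensors n u) by rewrite /is_mpu eU.
have canA' := coef_canonical_form d_gt0 mpuA'.
exists (coef_bonds d n), (coef_tensors n u); split=> // [k /andP[_ kN]|].
  exact: canonical_isometry.
by rewrite -eU; exact: mpo_drop_bond.
Qed.
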